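(* Let $K$ be a field, $n \ge 1$, $S = K[x_1,\dots,x_n]$, and let $I \subset S$ be a monomial ideal. Then Janet's algorithm gives a Stanley decomposition of $I$; that is, the finite collection $\mathcal{D}_n(I)$ of Stanley spaces produced by Janet's algorithm (as described in the context) satisfies $$I = \bigoplus_{uK[Z] \in \mathcal{D}_n(I)} uK[Z]$$ as $K$-vector spaces.
   Context: Stanley spaces. For a monomial $u \in S$ and a subset $Z \subseteq \{x_1,\dots,x_n\}$, $uK[Z]$ denotes the $K$-subspace of $S$ whose basis consists of all monomials $uv$ with $v$ a monomial in $K[Z]$; it is called a Stanley space of dimension $|Z|$. A Stanley decomposition of a $K$-subspace $V \subseteq S$ spanned by monomials is a presentation of $V$ as a finite direct sum of Stanley spaces (the empty sum being allowed when $V = 0$). Janet's algorithm for a monomial ideal. The order of the variables is fixed. The algorithm assigns to each monomial ideal $I \subset K[x_1,\dots,x_n]$ a finite collection $\mathcal{D}_n(I)$ of Stanley spaces, recursively on $n$. For $n = 1$: if $I = (x_1^a)$ then $\mathcal{D}_1(I) = \{x_1^a K[x_1]\}$; if $I = 0$ then $\mathcal{D}_1(I) = \emptyset$. For $n \ge 2$: put $S' = K[x_1,\dots,x_{n-1}]$. For $k \ge 0$ let $I_k \subset S'$ be the monomial ideal defined by $I \cap x_n^k S' = x_n^k I_k$, i.e. the monomials of $I_k$ are the monomials $u \in S'$ with $u x_n^k \in I$. One has $I_0 \subseteq I_1 \subseteq I_2 \subseteq \cdots$, and this chain stabilizes since $S'$ is Noetherian. If $I = 0$, put $\mathcal{D}_n(I)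 = \emptyset$. If $I \ne 0$, put $$\alpha = \min\{k : I_k \neq 0\}, \qquad \beta = \min\{k : I_k = I_\gamma \text{ for all } \gamma \ge k\},$$ and, with the recursively computed collections $\mathcal{D}_{n-1}(I_k)$, define $$\mathcal{D}_n(I) = \bigcup_{\alpha \le k < \beta} \{\, u x_n^k K[Z] : uK[Z] \in \mathcal{D}_{n-1}(I_k) \,\} \ \cup\ \{\, u x_n^{\beta} K[Z \cup \{x_n\}] : uK[Z] \in \mathcal{D}_{n-1}(I_\beta) \,\}.$$ *)

(* Defs.v *)
From mathcomp Require Import all_boot all_order all_algebra.
From mathcomp Require Import finmap.
From mathcomp Require Import boolp classical_sets.
From mathcomp Require Import mpoly.

Set Implicit Arguments.
Unset Strict Implicit.
Unset Printing Implicit Defensive.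

Import GRing.Theory.

Local Open Scope ring_scope.
Local Open Scope classical_set_scope.

Definition lin_span (K : fieldType) (V : lmodType K) (B : set V) : set V :=
  [set v | exists s : seq (K * V),
     {in s, forall cb, B cb.2} /\ v = \sum_(cb <- s) cb.1 *: cb.2].

Definition ideal_gen (R : comNzRingType) (A : set R) : set R :=
  [set r | exists s : seq (R * R),
     {in s, forall ca, A ca.2} /\ r = \sum_(ca <- s) ca.1 * ca.2].

Definition monomial_ideal (K : fieldType) (n : nat) (I : set {mpoly K[n]}) :
    Prop :=
  exists G : set 'X_{1..n}, I = ideal_gen [set 'X_[m] | m in G].

(* The pair (u, Z) stands for the Stanley space u K[Z], which determines it;
   a finite collection of Stanley spaces is a finite set of such pairs. *)
Notation stanley n := ('X_{1..n} * {set 'I_n})%type.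

Definition stanley_space (K : fieldType) (n : nat) (s : stanley n) :
    set {mpoly K[n]} :=
  lin_span [set 'X_[s.1] * 'X_[v] | v in
              [set v : 'X_{1..n} | forall i, i \notin s.2 -> v i = 0%N]].

(* The collection is indexed by the pairs themselves: each element of V is the
   sum of one component from each space of D, and this decomposition is unique. *)
Definition stanley_decomposition (K : fieldType) (n : nat)
    (V : set {mpoly K[n]}) (D : {fset stanley n}) : Prop :=
  V = [set p | exists w : stanley n -> {mpoly K[n]},
         {in D, forall s, stanley_space s (w s)} /\ p = \sum_(s <- D) w s]
  /\ (forall w : stanley n -> {mpoly K[n]},
        {in D, forall s, stanley_space s (w s)} ->
        \sum_(s <- D) w s = 0 -> {in D, forall s, w s = 0}).

(* 0 if P is empty *)
Definition min_nat (P : set nat) : nat :=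
  xget 0%N [set k | P k /\ forall j, P j -> (k <= j)%N].

(* K[x_1, ..., x_n] is embedded by mwiden in K[x_1, ..., x_(n+1)], whose last
   variable is 'X_ord_max. *)
Definition slice (K : fieldType) (n : nat) (I : set {mpoly K[n.+1]}) (k : nat) :
    set {mpoly K[n]} :=
  [set p | I (mwiden p * 'X_ord_max ^+ k)].

Definition janet_alpha (K : fieldType) (n : nat) (I : set {mpoly K[n.+1]}) :
    nat :=
  min_nat [set k | slice I k <> [set 0]].

Definition janet_beta (K : fieldType) (n : nat) (I : set {mpoly K[n.+1]}) :
    nat :=
  min_nat [set k | forall g, (k <= g)%N -> slice I k = slice I g].

Definition widen_set (n : nat) (Z : {set 'I_n}) : {set 'I_n.+1} :=
  [set widen_ord (leqnSn n) i | i in Z]%SET.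

(* u K[Z] |-> u x_(n+1)^k K[Z] *)
Definition shift_stanley (n k : nat) (s : stanley n) : stanley n.+1 :=
  ((mnmwiden s.1 + U_(ord_max) *+ k)%MM, widen_set s.2).

(* u K[Z] |-> u x_(n+1)^k K[Z, x_(n+1)] *)
Definition cone_stanley (n k : nat) (s : stanley n) : stanley n.+1 :=
  ((mnmwiden s.1 + U_(ord_max) *+ k)%MM, ord_max |: widen_set s.2)%SET.

(* janet n is the algorithm in n.+1 variables. *)
Fixpoint janet (K : fieldType) (n : nat) :
    set {mpoly K[n.+1]} -> {fset stanley n.+1} :=
  match n return set {mpoly K[n.+1]} -> {fset stanley n.+1} with
  | 0 => fun I =>
      if pselect (I = [set 0]) then fset0
      else let a := xget 0%N [set a | I = ideal_gen [set 'X_ord0 ^+ a]] in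
           [fset ((U_(ord0) *+ a)%MM, [set: 'I_1]%SET)]%fset
  | m.+1 => fun I =>
      if pselect (I = [set 0]) then fset0
      else
        let a := janet_alpha I in
        let b := janet_beta I in
        ((\bigcup_(k <- index_iota a b)
            [fset shift_stanley k s | s in janet (slice I k)])
         `|` [fset cone_stanley b s | s in janet (slice I b)])%fset
  end.

(* Main.v *)
Require Import Defs.
From mathcomp Require Import all_boot all_order all_algebra.
From mathcomp Require Import finmap.
From mathcomp Require Import boolp classical_sets.
From mathcomp Require Import mpoly.

(** A subspace spanned by monomials is determined by its set of exponents, so a
    Stanley decomposition of a monomial ideal is a partition of an up-closed
    set [M] of exponents into finitely many cones.  Slicing [M] by the last
    exponent gives an increasing chain of up-closed sets [M_k]; Janet's
    algorithm partitions level [k] like [M_k], and all the levels [k >= beta] at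
    once like [M_beta].  That the chain is stationary also follows from the
    induction hypothesis: it partitions the union of the chain into finitely
    many cones, so this union is generated by the finitely many apices, and
    these all belong to some [M_k]. *)

Set Implicit Arguments.
Unset Strict Implicit.
Unset Printing Implicit Defensive.

Import GRing.Theory.

Local Open Scope ring_scope.
Local Open Scope classical_set_scope.

(** * Up-closed sets of exponents and their partitions into cones *)

Definition up_closed (n : nat) (M : set 'X_{1..n}) : Prop :=
  forall m m', M m -> (m <= m')%MM -> M m'.

Definition stanley_cone (n : nat) (s : stanley n) : set 'X_{1..n} :=
  [set m | (s.1 <= m)%MM /\ forall i, i \notin s.2 -> m i = s.1 i].

(** Disjointness is expressed on the indices [s] and [t], to match a direct sum indexed by pairs. *)
Definition cone_partition (n : nat) (M : set 'X_{1..n})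
    (D : {fset stanley n}) : Prop :=
  (forall m, M m <-> exists2 s, s \in D & stanley_cone s m) /\
  (forall m s t, s \in D -> t \in D ->
     stanley_cone s m -> stanley_cone t m -> s = t).

Lemma stanley_cone_apex (n : nat) (s : stanley n) : stanley_cone s s.1.
Proof. by split=> //; apply: lepm_refl. Qed.

Lemma cone_partition_set0 (n : nat) : cone_partition (n := n) set0 fset0.
Proof. by split=> // m; split=> // -[s]; rewrite in_fset0. Qed.

(** * Subspaces spanned by monomials, seen through their exponents *)

Section MonomialSpaces.

Variables (K : fieldType) (n : nat).
Implicit Types (M N : set 'X_{1..n}) (p : {mpoly K[n]}) (D : {fset stanley n}).

Definition mon_space M : set {mpoly K[n]} :=
  [set p | forall m, m \in msupp p -> M m].

Lemma mon_spaceX M m : mon_space M 'X_[m] <-> M m.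
Proof.
split=> [|Mm m']; first by apply; rewrite msuppX mem_seq1.
by rewrite msuppX mem_seq1 => /eqP->.
Qed.

Lemma mon_space0 M : mon_space M 0.
Proof. by move=> m; rewrite msupp0. Qed.

Lemma mon_spaceD M p q : mon_space M p -> mon_space M q -> mon_space M (p + q).
Proof.
move=> Mp Mq m /msuppD_le; rewrite mem_cat => /orP[]; [exact: Mp|exact: Mq].
Qed.

Lemma mon_spaceZ M c p : mon_space M p -> mon_space M (c *: p).
Proof. by move=> Mp m /msuppZ_le; apply: Mp. Qed.

Lemma mon_space_sum (T : eqType) (r : seq T) (P : pred T)
    (F : T -> {mpoly K[n]}) M :
  (forall x, x \in r -> P x -> mon_space M (F x)) ->
  mon_space M (\sum_(x <- r | P x) F x).
Proof.
move=> MF; rewrite big_seq_cond.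
apply: (big_ind (mon_space M)) => [|p q|x /andP[]].
- exact: mon_space0.
- exact: mon_spaceD.
- exact: MF.
Qed.

Lemma mon_space_sub M N : M `<=` N -> mon_space M `<=` mon_space N.
Proof. by move=> MN p Mp m /Mp /MN. Qed.

(** The exponents are recovered from the monomials lying in the space. This carries equalities of
    ideals, as in [janet_beta], over to sets of exponents. *)
Lemma mon_space_inj : injective mon_space.
Proof.
move=> M N MN; apply/seteqP.
by split=> m /mon_spaceX; [rewrite MN | rewrite -MN] => /mon_spaceX.
Qed.

Lemma mon_space_set0 : mon_space set0 = [set 0].
Proof.
apply/seteqP; split=> p /= => [p0|->]; last exact: mon_space0.
apply: msuppnil0; case: (msupp p) (p0 : forall m, m \in msupp p -> _) => // m r.
by move/(_ m (mem_head _ _)).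
Qed.

Lemma mon_space_eq0 M : mon_space M = [set 0] <-> M = set0.
Proof.
rewrite -mon_space_set0; split=> [|->//]; exact: mon_space_inj.
Qed.

Lemma lin_span_monomials M :
  lin_span [set ('X_[m] : {mpoly K[n]}) | m in M] = mon_space M.
Proof.
apply/seteqP; split=> p.
  move=> [s [sM ->]]; apply: mon_space_sum => cb /sM [m Mm <-] _.
  by apply: mon_spaceZ; apply/mon_spaceX.
move=> Mp; exists [seq (p@_m, 'X_[m]) | m <- msupp p]; split.
  by move=> _ /mapP[m /Mp Mm ->]; exists m.
by rewrite big_map; apply: mpolyE.
Qed.

Lemma stanley_spaceE (s : stanley n) :
  stanley_space s = mon_space (stanley_cone s).
Proof.
rewrite -lin_span_monomials /stanley_space; congr lin_span.
apply/seteqP; split=> p [].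
  move=> v vZ <-; exists (s.1 + v)%MM; last by rewrite mpolyXD.
  split; first exact: lem_addr.
  by move=> i /vZ v0; rewrite mnmDE v0 addn0.
move=> m [le_sm mZ] <-; exists (m - s.1)%MM; last first.
  by rewrite -mpolyXD addmC submK.
by move=> i /mZ mi; rewrite mnmBE mi subnn.
Qed.

Lemma ideal_gen_monomials (G : set 'X_{1..n}) :
  ideal_gen [set ('X_[m] : {mpoly K[n]}) | m in G] =
  mon_space [set m | exists2 g, G g & (g <= m)%MM].
Proof.
apply/seteqP; split=> p.
  move=> [s [sG ->]]; apply: mon_space_sum => ca /sG [g Gg <-] _ m.
  rewrite (perm_mem (msuppMX _ _)) => /mapP[m' _ ->].
  by exists g => //; apply: lem_addr.
move=> Gp.
(* The induction runs over an arbitrary part [r] of the support, with [p] fixed. Each term is a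
   multiple of some generator ['X_[g]]. *)
have gen (r : seq 'X_{1..n}) : {subset r <= msupp p} ->
    ideal_gen [set ('X_[m] : {mpoly K[n]}) | m in G]
      (\sum_(m <- r) p@_m *: 'X_[m]).
  elim: r => [|m r IH] rp; first by exists [::]; rewrite !big_nil.
  have [|s [sG sE]] := IH; first by move=> x xr; apply: rp; rewrite inE xr orbT.
  have [|g Gg gm] := Gp m; first by apply: rp; rewrite mem_head.
  exists ((p@_m *: 'X_[m - g], 'X_[g]) :: s); split.
    by move=> x; rewrite inE => /orP[/eqP->|/sG//]; exists g.
  by rewrite !big_cons sE /= -scalerAl -mpolyXD submK.
by rewrite [p]mpolyE; apply: gen.
Qed.

(** Each exponent of [M] lies in exactly one cone, so each term of a polynomial belongs to exactly
    one component, and no cancellation between components is possible. *)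
Lemma cone_partition_stanley_decomposition M D :
  cone_partition M D -> stanley_decomposition (mon_space M) D.
Proof.
move=> [MD disjD]; split.
  apply/seteqP; split=> p.
    move=> Mp.
    exists (fun s => \sum_(m <- msupp p | `[< stanley_cone s m >]) p@_m *: 'X_[m]).
    split.
      move=> s _; rewrite stanley_spaceE; apply: mon_space_sum => m _ /asboolP sm.
      by apply: mon_spaceZ; apply/mon_spaceX.
    under eq_bigr do rewrite big_mkcond.
    (* With the sums exchanged, the term at [m] is counted once, by the only cone [s] through
       [m]. *)
    rewrite exchange_big {1}[p]mpolyE !big_seq; apply: eq_bigr => m /Mp /MD[s sD sm].
    rewrite (bigD1_seq s) //= asboolT // big_seq_cond big1 ?addr0 //.
    move=> t /andP[tD] /negP ts; case: asboolP => // tm; case: ts.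
    exact/eqP/(disjD m).
  move=> [w [wD ->]]; apply: mon_space_sum => s sD _.
  have := wD s sD; rewrite stanley_spaceE.
  by apply: mon_space_sub => m sm; apply/MD; exists s.
move=> w wD w0 s sD; apply/mpolyP => m; rewrite mcoeff0.
have w_out t : t \in D -> ~ stanley_cone t m -> (w t)@_m = 0.
  move=> tD tm; apply: memN_msupp_eq0; apply/negP => mw; apply: tm.
  by have := wD t tD; rewrite stanley_spaceE; apply.
have [sm|] := pselect (stanley_cone s m); last exact: w_out.
(* At an exponent [m] of the cone of [s], all other components have coefficient zero, so the
   vanishing sum gives that of [w s]. *)
have := congr1 (mcoeff m) w0; rewrite mcoeff0 raddf_sum (bigD1_seq s) //=.
rewrite big_seq_cond big1 ?addr0 // => t /andP[tD] /negP ts.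
by apply: w_out => // tm; case: ts; apply/eqP/(disjD m).
Qed.

End MonomialSpaces.

(** Nonemptiness rules out the default value 0 of [min_nat]. *)
Lemma min_natP (P : set nat) :
  (exists k, P k) -> P (min_nat P) /\ forall j, P j -> (min_nat P <= j)%N.
Proof.
move=> exP; rewrite /min_nat.
suff : exists k, [set k | P k /\ forall j, P j -> (k <= j)%N] k.
  by move/(xgetPex 0%N).
have [|k /asboolP Pk kmin] := @ex_minnP (fun k => `[< P k >]).
  by case: exP => k Pk; exists k; apply/asboolP.
by exists k; split=> // j Pj; apply: kmin; apply/asboolP.
Qed.

(** * Exponents, cones and slices with respect to the last variable *)

Local Notation mnm_rcons k m := (mnmwiden m + U_(ord_max) *+ k)%MM.

Section LastVariable.

Variable n : nat.
Implicit Types (m : 'X_{1..n}) (s : stanley n) (M : set 'X_{1..n.+1}).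

Definition mnm_slice M (k : nat) : set 'X_{1..n} :=
  [set m | M (mnm_rcons k m)].

Definition mnm_init (m : 'X_{1..n.+1}) : 'X_{1..n} :=
  [multinom m (widen_ord (leqnSn n) i) | i < n].

Lemma ord_maxVwiden (i : 'I_n.+1) :
  i = ord_max \/ exists j, i = widen_ord (leqnSn n) j.
Proof.
have := ltn_ord i; rewrite ltnS leq_eqVlt => /orP[/eqP iE|lt_in].
  by left; apply: val_inj.
by right; exists (Ordinal lt_in); apply: val_inj.
Qed.

Lemma mnm_rcons_max k m : mnm_rcons k m ord_max = k.
Proof. by rewrite mnmDE mnmwiden_ordmax mulmnE mnm1E eqxx mul1n. Qed.

Lemma mnm_rcons_widen k m (i : 'I_n) :
  mnm_rcons k m (widen_ord (leqnSn n) i) = m i.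
Proof.
rewrite mnmDE mnmwiden_widen mulmnE mnm1E.
by rewrite -val_eqE /= gtn_eqF ?ltn_ord // mul0n addn0.
Qed.

Lemma mnm_initK (m : 'X_{1..n.+1}) : mnm_rcons (m ord_max) (mnm_init m) = m.
Proof.
apply/mnmP => i; case: (ord_maxVwiden i) => [->|[j ->]].
  by rewrite mnm_rcons_max.
by rewrite mnm_rcons_widen mnmE.
Qed.

Lemma lem_rcons k l m m' :
  (mnm_rcons k m <= mnm_rcons l m')%MM = (k <= l)%N && (m <= m')%MM.
Proof.
apply/mnm_lepP/andP => [le_mm|[le_kl /mnm_lepP le_mm] i].
  split; first by have := le_mm ord_max; rewrite !mnm_rcons_max.
  by apply/mnm_lepP => i; have := le_mm (widen_ord (leqnSn n) i);
    rewrite !mnm_rcons_widen.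
case: (ord_maxVwiden i) => [->|[j ->]]; first by rewrite !mnm_rcons_max.
by rewrite !mnm_rcons_widen.
Qed.

Lemma widen_in_widen_set (Z : {set 'I_n}) i :
  (widen_ord (leqnSn n) i \in widen_set Z) = (i \in Z).
Proof. by apply: mem_imset => j l [/val_inj]. Qed.

Lemma max_notin_widen_set (Z : {set 'I_n}) : ord_max \notin widen_set Z.
Proof.
apply/imsetP => -[i _ /(congr1 val) /= iE].
by have := ltn_ord i; rewrite -iE ltnn.
Qed.

(** [ord_max] is outside the widened set, so the last exponent is frozen at its value in the
    apex. *)
Lemma shift_stanley_cone k l s m :
  stanley_cone (shift_stanley k s) (mnm_rcons l m) <->
  l = k /\ stanley_cone s m.
Proof.
rewrite /stanley_cone /= lem_rcons; split.
  case=> /andP[_ le_sm] out.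
  split; last split=> // i iZ.
    by have := out _ (max_notin_widen_set _); rewrite !mnm_rcons_max.
  have := out (widen_ord (leqnSn n) i); rewrite widen_in_widen_set.
  by rewrite !mnm_rcons_widen; apply.
case=> -> [-> out]; rewrite leqnn; split=> // i.
case: (ord_maxVwiden i) => [->|[j ->]]; first by rewrite !mnm_rcons_max.
by rewrite widen_in_widen_set !mnm_rcons_widen; apply: out.
Qed.

(** Here [ord_max] is a free direction, so the apex only bounds the last exponent from below. *)
Lemma cone_stanley_cone k l s m :
  stanley_cone (cone_stanley k s) (mnm_rcons l m) <->
  (k <= l)%N /\ stanley_cone s m.
Proof.
rewrite /stanley_cone /= lem_rcons; split.
  case=> /andP[-> le_sm] out; split=> //; split=> // i iZ.
  have := out (widen_ord (leqnSn n) i); rewrite !inE widen_in_widen_set.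
  by rewrite !mnm_rcons_widen -val_eqE /= ltn_eqF ?ltn_ord //; apply.
case=> -> [-> out]; split=> // i; rewrite !inE.
case: (ord_maxVwiden i) => [->|[j ->]]; first by rewrite eqxx.
by rewrite negb_or widen_in_widen_set !mnm_rcons_widen => /andP[_]; apply: out.
Qed.

Lemma mnm_slice_up_closed M k : up_closed M -> up_closed (mnm_slice M k).
Proof.
by move=> upM m m' Mm le_mm; apply: upM Mm _; rewrite lem_rcons leqnn.
Qed.

Lemma mnm_slice_mono M k l :
  up_closed M -> (k <= l)%N -> mnm_slice M k `<=` mnm_slice M l.
Proof.
by move=> upM le_kl m Mm; apply: upM Mm _; rewrite lem_rcons le_kl lepm_refl.
Qed.

Lemma slice_mon_space (K : fieldType) M k :
  slice (mon_space (K := K) M) k = mon_space (mnm_slice M k).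
Proof.
apply/seteqP; split=> p; rewrite /slice /= mpolyXn.
  (* The coefficient of the product at [mnm_rcons k m] is the coefficient of [p] at [m]. *)
  move=> Mp m mp; apply: Mp; rewrite mcoeff_msupp addmC mcoeffMX.
  by rewrite mwiden_mnmwiden -mcoeff_msupp.
move=> Mp; rewrite [p]mpolyE raddf_sum mulr_suml.
apply: mon_space_sum => m mp _; rewrite /= mwidenZ mwidenX -scalerAl -mpolyXD.
by apply: mon_spaceZ; apply/mon_spaceX; apply: Mp.
Qed.

Lemma cone_partition_stationary (M : nat -> set 'X_{1..n}) D :
  (forall k, up_closed (M k)) ->
  (forall k l, (k <= l)%N -> M k `<=` M l) ->
  cone_partition (\bigcup_k M k) D ->
  exists b, forall l, (b <= l)%N -> M b = M l.
Proof.
move=> upM monoM [MD _].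
have apex s : s \in D -> exists k, M k s.1.
  move=> sD; have [|k _ Mk] := (MD s.1).2; last by exists k.
  by exists s => //; apply: stanley_cone_apex.
(* The chain is increasing, so the maximum of finitely many stages serves all the apices. *)
have [b Mb] : exists b, forall s, s \in D -> M b s.1.
  have fin (r : seq (stanley n)) : (forall s, s \in r -> exists k, M k s.1) ->
      exists b, forall s, s \in r -> M b s.1; last exact: fin apex.
  elim: r {MD apex} => [|s r IH] apex; first by exists 0%N.
  have [|b Mb] := IH; first by move=> t tr; apply: apex; rewrite inE tr orbT.
  have [|k Mk] := apex s; first exact: mem_head.
  exists (maxn b k) => t; rewrite inE => /orP[/eqP->|/Mb].
    by apply: monoM Mk; apply: leq_maxr.
  by apply: monoM; apply: leq_maxl.
exists b => l le_bl; apply/seteqP; split; first exact: monoM.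
move=> m Mm; have [|s sD [le_sm _]] := (MD m).1; first by exists l.
exact: upM (Mb _ sD) le_sm.
Qed.

End LastVariable.

(** * Janet's algorithm partitions the exponents of the ideal *)

Section Janet.

Variable K : fieldType.

Lemma janet_set0 n : janet (mon_space (K := K) (n := n.+1) set0) = fset0.
Proof.
by case: n => [|n] /=; case: pselect => // -[]; apply: mon_space_set0.
Qed.

Lemma lem_univariate (m m' : 'X_{1..1}) :
  (m <= m')%MM = (m ord0 <= m' ord0)%N.
Proof.
apply/mnm_lepP/idP => [|le_mm i]; first exact.
by have -> : i = ord0 by apply/val_inj; case: i => -[].
Qed.

Lemma mnm_pow_univariate a : (U_(ord0 : 'I_1) *+ a)%MM ord0 = a.
Proof. by rewrite mulmnE mnm1E eqxx mul1n. Qed.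

(** Exponents in one variable are totally ordered, so a nonempty up-closed set is the cone over its
    least element. *)
Lemma janet_partition1 (M : set 'X_{1..1}) :
  up_closed M -> cone_partition M (janet (mon_space (K := K) M)).
Proof.
move=> upM; have [->|M0] := pselect (M = set0).
  by rewrite janet_set0; apply: cone_partition_set0.
rewrite /=; case: pselect => [/[dup]/mon_space_eq0 //|? /=].
set A := [set a | _].
have genE a : ideal_gen [set ('X_ord0 ^+ a : {mpoly K[1]})] =
    mon_space [set m | (a <= m ord0)%N].
  have -> : [set ('X_ord0 ^+ a : {mpoly K[1]})] =
      [set 'X_[m] | m in [set (U_(ord0) *+ a)%MM]].
    by rewrite image_set1 mpolyXn.
  rewrite ideal_gen_monomials; congr mon_space; apply/seteqP; split=> m /=.
    by case=> g ->; rewrite lem_univariate mnm_pow_univariate.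
  move=> le_am; exists (U_(ord0) *+ a)%MM => //.
  by rewrite lem_univariate mnm_pow_univariate.
have exA : exists a, A a.
  have [m0 Mm0] : exists m, M m.
    apply: contrapT => nM; apply: M0; apply/seteqP.
    by split=> // m Mm; apply: nM; exists m.
  have [|_ /asboolP[m Mm <-] amin] :=
      @ex_minnP (fun a => `[< exists2 m, M m & m ord0 = a >]).
    by exists (m0 ord0); apply/asboolP; exists m0.
  exists (m ord0); rewrite /A /= genE; congr mon_space; apply/seteqP; split.
    by move=> m' Mm' /=; apply: amin; apply/asboolP; exists m'.
  by move=> m' le_mm; apply: upM Mm _; rewrite lem_univariate.
(* As [A] is inhabited, [xget] returns a true generator exponent rather than the default 0, and [M]
   is the set of exponents at least [a]. *)
have := xgetPex 0%N exA; set a := xget _ _.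
rewrite /A /= genE => /mon_space_inj ->.
split=> [m|m s t]; last by rewrite !inE => /eqP-> /eqP->.
split=> [/= le_am|[s]].
  exists ((U_(ord0) *+ a)%MM, [set: 'I_1]%SET); first by rewrite inE.
  split=> [|i]; last by rewrite inE.
  by rewrite lem_univariate mnm_pow_univariate.
by rewrite inE => /eqP-> []; rewrite lem_univariate mnm_pow_univariate.
Qed.

Lemma janet_partition n (M : set 'X_{1..n.+1}) :
  up_closed M -> cone_partition M (janet (mon_space (K := K) M)).
Proof.
elim: n M => [|n IH] M upM; first exact: janet_partition1.
have [->|M0] := pselect (M = set0).
  by rewrite janet_set0; apply: cone_partition_set0.
rewrite [janet _]/=; case: pselect => [/[dup]/mon_space_eq0 //|? /=].
set a := janet_alpha _; set b := janet_beta _.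
set N := mnm_slice M.
have upN k : up_closed (N k) by apply: mnm_slice_up_closed.
have stab_b l : (b <= l)%N -> N b = N l.
  have [|stab _] := @min_natP [set k | forall g, (k <= g)%N ->
      slice (mon_space (K := K) M) k = slice (mon_space M) g].
    (* The minimum defining [b] is attained only if the chain of slices stabilizes; the induction
       hypothesis, applied to the union of the slices, provides this. *)
    have [||c Hc] := cone_partition_stationary upN _ (IH (\bigcup_k N k) _).
    - by move=> k k'; apply: mnm_slice_mono.
    - by move=> m m' [k _ Nm] le_mm; exists k => //; apply: upN Nm le_mm.
    - by exists c => l' /Hc Nc; rewrite !slice_mon_space -/N Nc.
  by move/stab; rewrite !slice_mon_space; apply: mon_space_inj.
(* The levels skipped by the algorithm are empty: a nonempty one would contradict the minimality of
   [a]. *)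
have below_a k : (k < a)%N -> N k = set0.
  move=> lt_ka; apply: contrapT => Nk.
  have Pk : [set k | slice (mon_space (K := K) M) k <> [set 0]] k.
    by rewrite /= slice_mon_space => /mon_space_eq0.
  have [_ /(_ k Pk)] := @min_natP _ (ex_intro _ k Pk).
  by rewrite leqNgt lt_ka.
have inD s : s \in ((\bigcup_(k <- index_iota a b)
      [fset shift_stanley k s | s in janet (slice (mon_space (K := K) M) k)])
    `|` [fset cone_stanley b s | s in janet (slice (mon_space (K := K) M) b)])%fset
  <-> (exists k, exists2 t, (a <= k < b)%N /\
         t \in janet (mon_space (K := K) (N k)) & s = shift_stanley k t) \/
      (exists2 t, t \in janet (mon_space (K := K) (N b)) & s = cone_stanley b t).
  rewrite in_fsetU; split=> [/orP[/bigfcupP[k]|/imfsetP[t]]|].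
  - rewrite mem_index_iota andbT slice_mon_space => kab /imfsetP[t tD ->].
    by left; exists k, t.
  - by rewrite slice_mon_space => tD ->; right; exists t.
  case=> [[k [t [kab tD ->]]]|[t tD ->]]; apply/orP; [left|right].
    apply/bigfcupP; exists k; first by rewrite mem_index_iota kab.
    by rewrite slice_mon_space; apply/imfsetP; exists t.
  by rewrite slice_mon_space; apply/imfsetP; exists t.
split=> m; rewrite -(mnm_initK m); set l := m ord_max; set m' := mnm_init m.
  have -> : M (mnm_rcons l m') <-> N l m' by [].
  split=> [Nm|[s /inD[[k [t [kab tD ->]]]|[t tD ->]]]].
  (* From level [b] on, the slice equals [N b] and the cone pieces cover it; a nonempty level under
     [b] is at least [a] and is covered by shifted pieces. *)
  - have [le_bl|lt_lb] := leqP b l.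
      move: Nm; rewrite -(stab_b l) // => /(IH _ (upN b)).1[t tD tm].
      exists (cone_stanley b t); first by apply/inD; right; exists t.
      exact/cone_stanley_cone.
    have le_al : (a <= l)%N.
      by rewrite leqNgt; apply/negP => /below_a Nl; move: Nm; rewrite Nl.
    move: Nm => /(IH _ (upN l)).1[t tD tm].
    exists (shift_stanley l t); last exact/shift_stanley_cone.
    by apply/inD; left; exists l, t => //; rewrite le_al.
  - by case/shift_stanley_cone=> -> tm; apply/(IH _ (upN k)).1; exists t.
  - case/cone_stanley_cone=> le_bl tm; rewrite -(stab_b l) //.
    by apply/(IH _ (upN b)).1; exists t.
(* Two shifted pieces that meet share the level [l], hence come from the same slice; a shifted piece
   lives strictly under level [b], a cone piece at or above it; two cone pieces both come from
   [N b]. *)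
move=> s t /inD[[k [s' [kab sD ->]]]|[s' sD ->]]
  /inD[[k' [t' [kab' tD ->]]]|[t' tD ->]].
- move=> /shift_stanley_cone[lk sm] /shift_stanley_cone[lk' tm].
  rewrite -lk -lk' in sD tD *; congr shift_stanley.
  exact: (IH _ (upN l)).2 sm tm.
- move=> /shift_stanley_cone[lk sm] /cone_stanley_cone[].
  by rewrite lk leqNgt; case/andP: kab => _ ->.
- move=> /cone_stanley_cone[+ _] /shift_stanley_cone[lk tm].
  by rewrite lk leqNgt; case/andP: kab' => _ ->.
- move=> /cone_stanley_cone[_ sm] /cone_stanley_cone[_ tm].
  congr cone_stanley; exact: (IH _ (upN b)).2 sm tm.
Qed.

End Janet.

Theorem lemma2p1 (K : fieldType) (n : nat) (I : set {mpoly K[n.+1]})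
    (hI : monomial_ideal I) :
  stanley_decomposition I (janet I).
Proof.
case: hI => G ->; rewrite ideal_gen_monomials.
apply/cone_partition_stanley_decomposition/janet_partition.
by move=> m m' [g Gg le_gm] le_mm; exists g => //; apply: lepm_trans le_mm.
Qed.
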